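(* Let $T=(T(x))_{x\ge 0}$ be a driftless subordinator with nonzero Lévy measure $\nu$, so that $\mathbb{E}(e^{-uT(x)})=e^{-x\psi(u)}$ for $u>0$, $x\ge 0$, with Laplace exponent $\psi(u)=\int_0^\infty (1-e^{-uy})\,\nu(dy)$, and let $E(t)=\inf\{s\ge 0: T(s)>t\}$ be the inverse subordinator. Let $\psi'^{-1}$ denote the inverse function of the derivative $\psi'$. Then for every $t>0$ and all sufficiently large $x$, $$\mathbb{P}(E(t)>x)\le \exp\Bigl(t\,\psi'^{-1}(t/x)-x\,\psi\bigl(\psi'^{-1}(t/x)\bigr)\Bigr).$$
   Context: A subordinator is a one-dimensional Lévy process started at $0$ with almost surely non-decreasing sample paths. In general its Laplace exponent is $\psi(u)=bu+\int_0^\infty(1-e^{-uy})\,\nu(dy)$ with $b\ge 0$ and $\int_0^\infty (1\wedge y)\,\nu(dy)<\infty$; ''driftless'' means $b=0$. Then $\psi'(u)=\int_0^\infty y e^{-uy}\,\nu(dy)$ is strictly decreasing on $(0,\infty)$ with $\psi'(u)\downarrow 0$ as $u\uparrow\infty$, so $\psi'$ is invertible from $(0,\infty)$ onto $(0,\psi'(0+))$, and $\psi'^{-1}(t/x)$ is defined for all sufficiently large $x$. *)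

(* Defs.v *)
From HB Require Import structures.
From mathcomp Require Export all_boot all_order all_algebra.
From mathcomp Require Export all_classical all_reals all_analysis.
Export Order.TTheory GRing.Theory Num.Theory.
Export numFieldNormedType.Exports.

#[export] Set Implicit Arguments.
#[export] Unset Strict Implicit.
#[export] Unset Printing Implicit Defensive.
Global Open Scope classical_set_scope.
Global Open Scope ring_scope.

(* A process (T(x))_{x >= 0} is a family indexed by all of R, of which only the
   indices x >= 0 are ever constrained or used. *)

(* The Borel sets B i are arbitrary (setT included), so the product rule for all
   n increments gives it for every subfamily of them. *)
Definition independent_increments (d : measure_display)
    (Omega : measurableType d) (R : realType) (P : probability Omega R)
    (T : R -> {RV P >-> R}) : Prop :=
  forall (n : nat) (t : nat -> R) (B : nat -> set R),
    0 <= t 0%N -> (forall i, (i < n)%N -> t i <= t i.+1) ->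
    (forall i, measurable (B i)) ->
    P [set w | forall i, (i < n)%N -> B i (T (t i.+1) w - T (t i) w)] =
    (\prod_(i < n) fine (P [set w | B i (T (t i.+1) w - T (t i) w)]))%:E.

Definition stationary_increments (d : measure_display)
    (Omega : measurableType d) (R : realType) (P : probability Omega R)
    (T : R -> {RV P >-> R}) : Prop :=
  forall (s h : R) (B : set R), 0 <= s -> 0 <= h -> measurable B ->
    P [set w | B (T (s + h) w - T s w)] = P [set w | B (T h w - T 0 w)].

Definition stochastically_continuous (d : measure_display)
    (Omega : measurableType d) (R : realType) (P : probability Omega R)
    (T : R -> {RV P >-> R}) : Prop :=
  forall s e : R, 0 <= s -> 0 < e ->
    P [set w | e < `|T r w - T s w|]
      @[r --> within [set r | 0 <= r] (nbhs s)] --> 0%:E.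

Definition cadlag (R : realType) (f : R -> R) : Prop :=
  forall s : R, 0 <= s ->
    (f r @[r --> s^'+] --> f s) /\ (0 < s -> cvg (f r @[r --> s^'-])).

Record levy_process (d : measure_display) (Omega : measurableType d)
    (R : realType) (P : probability Omega R) (T : R -> {RV P >-> R}) : Prop := {
  levy_start0 : \forall w \ae P, T 0 w = 0 ;
  levy_independent : independent_increments T ;
  levy_stationary : stationary_increments T ;
  levy_stochastically_continuous : stochastically_continuous T ;
  levy_cadlag : \forall w \ae P, cadlag (fun s => T s w) }.

Record subordinator (d : measure_display) (Omega : measurableType d)
    (R : realType) (P : probability Omega R) (T : R -> {RV P >-> R}) : Prop := {
  subordinator_levy : levy_process T ;
  subordinator_nondecreasing : \forall w \ae P,
    forall s r : R, 0 <= s -> s <= r -> T s w <= T r w }.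

(* Lévy measures of subordinators, as measures on R carried by ]0, +oo[. *)
Record subordinator_levy_measure (R : realType)
    (nu : {measure set R -> \bar R}) : Prop := {
  levy_measure_carried : nu (~` `]0, +oo[) = 0%E ;
  levy_measure_integrable :
    (\int[nu]_(y in `]0%R, +oo[) (Num.min 1 y)%:E < +oo)%E }.

(* The Laplace exponent with zero drift and Lévy measure nu. The integral is
   finite for u >= 0; the values at u < 0 are not used. *)
Definition laplace_exponent (R : realType)
    (nu : {measure set R -> \bar R}) (u : R) : R :=
  \int[nu]_(y in `]0, +oo[) (1 - expR (- (u * y))).

Definition driftless_subordinator (d : measure_display)
    (Omega : measurableType d) (R : realType) (P : probability Omega R)
    (nu : {measure set R -> \bar R})
    (T : R -> {RV P >-> R}) : Prop :=
  [/\ subordinator T, subordinator_levy_measure nu &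
    forall u x : R, 0 < u -> 0 <= x ->
      'E_P[fun w => expR (- (u * T x w))]%E =
      (expR (- (x * laplace_exponent nu u)))%:E].

(* Extended-real valued: E(t) = +oo on paths that never exceed t. *)
Definition inverse_subordinator (d : measure_display)
    (Omega : measurableType d) (R : realType) (P : probability Omega R)
    (T : R -> {RV P >-> R}) (t : R) (w : Omega) : \bar R :=
  ereal_inf [set s%:E | s in [set s : R | 0 <= s /\ t < T s w]].

(* The inverse of the restriction of psi' to ]0, +oo[; outside the range of this
   restriction its value is the arbitrary 0. *)
Definition laplace_exponent'_inv (R : realType)
    (nu : {measure set R -> \bar R}) : R -> R :=
  'pinv_(fun=> 0) `]0, +oo[ (derive1 (laplace_exponent nu)).

(* The completion of P. As paths are monotone and right-continuous only almost
   surely, the events {E(t) > x} belong to the completed sigma-algebra but maybe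
   not to the given one, and off the latter the values of P are unspecified.
   P being finite, its completion is the Carathéodory extension; the two
   agree on measurable sets (sub_caratheodory, measurable_mu_extE). *)
Definition completed_event (d : measure_display) (Omega : measurableType d)
    (R : realType) (P : probability Omega R) (A : set Omega) : Prop :=
  (mu_ext P).-cara.-measurable A.

Definition completed_probability (d : measure_display)
    (Omega : measurableType d) (R : realType) (P : probability Omega R)
    (A : set Omega) : \bar R :=
  mu_ext P A.

(* Main.v *)
(* On {E(t) > x} one has T(x) <= t, so for every u > 0 the exponential Markov
   inequality for -T(x) bounds P(E(t) > x) by exp(t u - x psi(u)). It remains to
   see that u = psi'^{-1}(t/x) makes sense for large x: psi' is given by
   differentiation under the integral sign, is continuous and positive on
   (0, +oo) and tends to 0 at infinity, hence takes every value in
   (0, psi'(1)]. Up to the null set of non-monotone paths, {E(t) > x} is the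
   countable union of the events {T(x + 1/n) <= t}. *)
Require Import Defs.
From mathcomp Require Import measurable_realfun ring lra.

(** * Integrability against the Lévy measure *)

Section psi.
Context (R : realType) (nu : {measure set R -> \bar R}).
Hypothesis nuL : subordinator_levy_measure nu.

Lemma min1_integrable :
  nu.-integrable `]0, +oo[ (EFin \o (fun y : R => Num.min 1 y)).
Proof.
apply/integrableP; split.
  by apply/measurable_EFinP; exact: measurable_minr.
rewrite (eq_integral (fun y : R => (Num.min 1 y)%:E)).
  by case: nuL.
move=> y /set_mem /=; rewrite in_itv/= andbT => y0.
by rewrite ger0_norm// le_min ler01 ltW.
Qed.

Lemma scale_min1_integrable (C : R) :
  nu.-integrable `]0, +oo[ (EFin \o (fun y : R => C * Num.min 1 y)).
Proof.
rewrite (_ : EFin \o _ = (fun y : R => C%:E * (Num.min 1 y)%:E)%E).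
  by apply: integrableZl => //; exact: min1_integrable.
by apply/funext => y /=; rewrite EFinM.
Qed.

(** Every integrability claim below reduces to domination by a multiple of [min 1 y], as [nu] may
    have infinite mass near 0. *)
Lemma le_min1_integrable (C : R) (f : R -> R) : measurable_fun setT f ->
  (forall y, 0 < y -> `|f y| <= C * Num.min 1 y) ->
  nu.-integrable `]0, +oo[ (EFin \o f).
Proof.
move=> mf fC.
apply: (le_integrable _ _ _ (scale_min1_integrable C)) => //.
  by apply: measurable_funTS; exact/measurable_EFinP.
move=> y /=; rewrite in_itv/= andbT => y0.
by rewrite lee_fin (le_trans (fC _ y0))// ler_norm.
Qed.

Lemma one_sub_expR_le (u y : R) : 0 < u -> 0 < y ->
  `|1 - expR (- (u * y))| <= (1 + u) * Num.min 1 y.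
Proof.
move=> u0 y0.
have uy : 0 < u * y by exact: mulr_gt0.
have := expR_ge0 (- (u * y)).
have := expR_ge1Dx (- (u * y)).
have e1 : expR (- (u * y)) <= 1 by rewrite expR_le1; lra.
(* For y > 1 the left side is at most 1, otherwise at most u y. *)
by rewrite ger0_norm ?subr_ge0//; rewrite /Num.min; case: ifPn; nra.
Qed.

Lemma mul_expR_le_inv (u y : R) : 0 < u -> y * expR (- (u * y)) <= u^-1.
Proof.
move=> u0; rewrite -[leRHS]mulr1 ler_pdivlMl// expRN mulrA.
rewrite ler_pdivrMr ?expR_gt0// mul1r (le_trans _ (expR_ge1Dx _))//.
by rewrite lerDr.
Qed.

(** The left side is at most y and at most 1/u <= 1/a. The constant depends on [a] only, so the
    bound is uniform in u >= a, as domination under the integral sign requires. *)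
Lemma mul_expR_le (a u y : R) : 0 < a -> a <= u -> 0 < y ->
  `|y * expR (- (u * y))| <= (1 + a^-1) * Num.min 1 y.
Proof.
move=> a0 au y0.
have e1 : expR (- (u * y)) <= 1 by rewrite expR_le1; nra.
have ai : 0 < a^-1 by rewrite invr_gt0.
rewrite ger0_norm ?mulr_ge0 ?expR_ge0 ?(ltW y0)//.
have e0 := expR_ge0 (- (u * y)).
have ya : y * expR (- (u * y)) <= a^-1.
  by rewrite (le_trans (mul_expR_le_inv _ _))// ?lef_pV2 ?posrE; lra.
by rewrite /Num.min; case: ifPn => _; nra.
Qed.

Lemma continuous_expRNM (u : R) : continuous (fun y => expR (- (u * y))).
Proof.
move=> y; apply: (continuous_comp (f := fun y => - (u * y)) (g := @expR R)).
  by apply: continuousN; apply: continuousM; [exact: cvg_cst|exact: cvg_id].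
exact: continuous_expR.
Qed.

Lemma one_sub_expR_integrable (u : R) : 0 < u ->
  nu.-integrable `]0, +oo[ (EFin \o (fun y : R => 1 - expR (- (u * y)))).
Proof.
move=> u0; apply: le_min1_integrable => [|y]; last exact: one_sub_expR_le.
apply: measurable_funB => //; apply: continuous_measurable_fun.
exact: continuous_expRNM.
Qed.

Lemma mul_expR_measurable (u : R) :
  measurable_fun setT (fun y : R => y * expR (- (u * y))).
Proof.
apply: measurable_funM => //; apply: continuous_measurable_fun.
exact: continuous_expRNM.
Qed.

Lemma mul_expR_integrable (u : R) : 0 < u ->
  nu.-integrable `]0, +oo[ (EFin \o (fun y : R => y * expR (- (u * y)))).
Proof.
move=> u0; apply: le_min1_integrable => [|y]; first exact: mul_expR_measurable.
exact: mul_expR_le u0 (lexx u).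
Qed.

(** * The derivative of psi and its range *)

Lemma is_derive_laplace_integrand (y u : R) :
  is_derive u 1 (fun u => 1 - expR (- (u * y))) (y * expR (- (u * y))).
Proof.
apply: is_derive_eq.
by rewrite scaler0 add0r [y%:A]mulr1 add0r mul1r mulrN opprK mulrC.
Qed.

Let slope (u : R) := \int[nu]_(y in `]0, +oo[) (y * expR (- (u * y))).

Lemma laplace_exponent_derive1 (a : R) : 0 < a ->
  derive1 (laplace_exponent nu) a = slope a.
Proof.
move=> a0.
(* This neighbourhood of [a] stays away from 0, so [mul_expR_le] holds on it with the single
   constant 1 + (a/2)^-1. *)
have ale u : `](a / 2), (a + 1)[%classic u -> a / 2 <= u.
  by rewrite /= in_itv/= => /andP[/ltW].
have a20 : 0 < a / 2 by rewrite divr_gt0.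
have d1 (u y : R) : partial1of2 (fun u y : R => 1 - expR (- (u * y))) u y =
    y * expR (- (u * y)).
  rewrite partial1of2E.
  by have [_ ->] := is_derive_laplace_integrand y u.
rewrite (@differentiation_under_integral R _ _ nu
  (fun u y : R => 1 - expR (- (u * y))) `]0, +oo[ _ a (a / 2) (a + 1) _ _ _
  (* The absolute value makes the dominating function nonnegative at y < 0 too. *)
  (fun y : R => `|(1 + (a / 2)^-1) * Num.min 1 y|)) //.
- by apply: eq_Rintegral => y _; exact: d1.
- by rewrite /= in_itv/=; lra.
- by move=> u /ale au; apply: one_sub_expR_integrable; lra.
- exact: integrable_norm (scale_min1_integrable _).
- move=> u y /ale au; rewrite /= in_itv/= andbT => y0; rewrite d1.
  by apply: le_trans (ler_norm _); exact: mul_expR_le.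
Qed.

Lemma slope_continuous (a : R) : 0 < a -> {for a, continuous slope}.
Proof.
move=> a0.
have ale u : `](a / 2), (a + 1)[%classic u -> a / 2 <= u.
  by rewrite /= in_itv/= => /andP[/ltW].
have a20 : 0 < a / 2 by rewrite divr_gt0.
apply: (@continuity_under_integral R _ _ nu
  (fun u y : R => y * expR (- (u * y))) `]0, +oo[ _ (a / 2) (a + 1) _ _
  (fun y : R => (1 + (a / 2)^-1) * Num.min 1 y)) => //.
- by move=> u /ale au; apply: mul_expR_integrable; lra.
- apply: aeW => y _ u _; apply: differentiable_continuous.
  by apply/derivable1_diffP.
- exact: scale_min1_integrable.
- move=> u /ale au; apply: aeW => y; rewrite /= in_itv/= andbT => y0.
  exact: mul_expR_le.
- by rewrite inE /= in_itv/=; lra.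
Qed.

(** Dominated convergence: the integrand is at most 1/(n+1), and n+1 >= 1 allows the uniform bound
    with [a] = 1. *)
Lemma slope_cvg0 : slope n.+1%:R @[n --> \oo] --> 0.
Proof.
have ub n (y : R) : 0 < y ->
    `|y * expR (- (n.+1%:R * y))| <= (1 + 1^-1) * Num.min 1 y.
  by apply: mul_expR_le => //; rewrite ler1n.
have [|||||_ _] := @dominated_convergence _ _ R nu `]0, +oo[ (measurable_itv _)
  (fun n (y : R) => (y * expR (- (n.+1%:R * y)))%:E) (cst 0%E)
  (fun y : R => ((1 + 1^-1) * Num.min 1 y)%:E).
- move=> n; apply: measurable_funTS; apply/measurable_EFinP.
  exact: mul_expR_measurable.
- exact: measurable_cst.
- apply: aeW => y; rewrite /= in_itv/= andbT => y0.
  apply: cvg_EFin; first exact: nearW.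
  apply: (squeeze_cvgr _ (cvg_cst 0) (@cvg_harmonic R)).
  apply: nearW => n /=; rewrite mulr_ge0 ?expR_ge0 ?(ltW y0)//=.
  exact: mul_expR_le_inv.
- exact: scale_min1_integrable.
- apply: aeW => y n; rewrite /= in_itv/= andbT => y0.
  by rewrite lee_fin; exact: ub.
by rewrite integral0 => /fine_cvg.
Qed.

(** If the integral of this nonnegative function were 0, the function would vanish almost everywhere
    on []0, +oo[]; it vanishes nowhere there, so []0, +oo[] would be a null set. *)
Lemma slope_gt0 (u : R) : 0 < u -> nu [set` `]0, +oo[] != 0%E -> 0 < slope u.
Proof.
move=> u0; apply: contraNT; rewrite -leNgt => s0.
have f0 (y : R) : `]0, +oo[%classic y -> 0 <= y * expR (- (u * y)).
  by rewrite /= in_itv/= andbT => /ltW y0; rewrite mulr_ge0 ?expR_ge0.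
have fi := mul_expR_integrable u0.
have if0 : (\int[nu]_(y in `]0%R, +oo[) (y * expR (- (u * y)))%:E = 0)%E.
  apply/eqP; rewrite -fine_eq0; last exact: integrable_fin_num.
  by rewrite eq_le s0/=; exact: Rintegral_ge0.
have [N [mN N0 DN]] : ae_eq nu [set` `]0, +oo[]
    (fun y : R => (y * expR (- (u * y)))%:E) (cst 0%E).
  apply/ae_eq_integral_abs => //.
    by have /integrableP[] := fi.
  rewrite -if0; apply: eq_integral => y /set_mem Dy.
  by rewrite gee0_abs// lee_fin f0.
apply/eqP; apply: (subset_measure0 _ mN) => // y /= Dy.
apply: DN => /= /(_ Dy) [] /eqP.
rewrite mulf_eq0 expR_eq0 orbF.
by move: Dy; rewrite in_itv/= andbT => /gt_eqF ->.
Qed.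

(** Intermediate values on [1, n+1], with n so large that [slope] at n+1 is below v. *)
Lemma laplace_exponent_derive1_onto (v : R) : 0 < v < slope 1 ->
  (derive1 (laplace_exponent nu) @` [set` `]0, +oo[]) v.
Proof.
move=> /andP[v0 v1].
have [n _ /(_ n (leqnn n)) sn] := cvgr_lt _ slope_cvg0 _ v0.
have n1 : 1 <= n.+1%:R :> R by rewrite ler1n.
have [||c] := @IVT R slope 1 n.+1%:R v n1.
- apply: continuous_in_subspaceT => x; rewrite inE/= in_itv/= => /andP[x1 _].
  by apply: slope_continuous; exact: lt_le_trans x1.
- by rewrite ge_min le_max (ltW v1) (ltW sn) orbT.
rewrite in_itv/= => /andP[c1 _] <-; exists c.
  by rewrite /= in_itv/= andbT (lt_le_trans _ c1).
by rewrite laplace_exponent_derive1// (lt_le_trans _ c1).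
Qed.

End psi.

(** On the range of psi' the partial inverse picks a genuine preimage in []0, +oo[], never the
    default 0. *)
Lemma laplace_exponent'_inv_gt0 (R : realType)
    (nu : {measure set R -> \bar R}) (v : R) :
  (derive1 (laplace_exponent nu) @` [set` `]0, +oo[]) v ->
  0 < laplace_exponent'_inv nu v.
Proof.
move=> fv.
have := @surjpinv_image_sub _ _ (fun=> 0) [set` `]0, +oo[] _
  (derive1 (laplace_exponent nu)) (@subset_refl _ _).
move=> /(_ (laplace_exponent'_inv nu v)) /=.
by rewrite in_itv/= andbT; apply; exists v.
Qed.

(** * The event {E(t) > x} and its probability *)

Section inverse_subordinator.
Context (R : realType) (d : measure_display) (Omega : measurableType d)
  (P : probability Omega R) (nu : {measure set R -> \bar R})
  (T : R -> {RV P >-> R}).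

Lemma inverse_subordinator_gt_le (t x : R) (w : Omega) : 0 <= x ->
  (x%:E < inverse_subordinator T t w)%E -> T x w <= t.
Proof.
move=> x0; rewrite leNgt; apply: contraTN => tT; rewrite -leNgt.
by apply: ereal_inf_lbound; exists x.
Qed.

Lemma measurable_le_RV (X : {RV P >-> R}) (t : R) :
  measurable [set w | X w <= t].
Proof.
rewrite -[X in measurable X]setTI.
have -> : [set w | X w <= t] = X @^-1` `]-oo, t]%classic.
  by apply/seteqP; split => w /=; rewrite in_itv.
exact: measurable_funP.
Qed.

Lemma negligible_completed_event (N : set Omega) :
  P.-negligible N -> completed_event P N.
Proof.
move=> [B [mB B0 NB]]; apply: measure_is_complete_caratheodory.
exists B; split => //; first exact: caratheodory_measurable_mu_ext.
exact: etrans (measurable_mu_extE P mB) B0.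
Qed.

Lemma inverse_subordinator_event (t x : R) : 0 <= x ->
  (\forall w \ae P, forall s r : R, 0 <= s -> s <= r -> T s w <= T r w) ->
  completed_event P [set w | (x%:E < inverse_subordinator T t w)%E].
Proof.
move=> x0 Tmon; set A := [set w | _].
(* The shift by 1/(n+1) secures the strict inequality: on a monotone path T(x) <= t gives only E(t)
   >= x. *)
pose M := \bigcup_n [set w | T (x + n.+1%:R^-1) w <= t].
have AM : A `<=` M.
  move=> w; rewrite /A/=; set e := inverse_subordinator T t w => xe.
  suff [n xne] : exists n, ((x + n.+1%:R^-1)%:E < e)%E.
    exists n => //=; apply: inverse_subordinator_gt_le xne.
    by rewrite addr_ge0// invr_ge0.
  case: e xe => [r| |//] xr; last by exists 0; rewrite ltry.
  have rx : 0 < r - x by rewrite subr_gt0 -lte_fin.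
  have [n _ /(_ n (leqnn n)) nr] := near_infty_natSinv_lt (PosNum rx).
  by exists n; rewrite lte_fin -ltrBrDl.
(* [M] is measurable and [M \ A] lies in the null set of non-monotone paths. *)
have -> : A = M `\` (M `\` A) by rewrite setDD setIidr.
apply: caratheodory_measurable_setD.
  apply: caratheodory_measurable_mu_ext.
  by apply: bigcupT_measurable => n; exact: measurable_le_RV.
apply: negligible_completed_event; apply: negligibleS Tmon => w [[n _ /= Tn] nA].
move=> Tw; apply: nA; rewrite /A/=.
apply: (@lt_le_trans _ _ (x + n.+1%:R^-1)%:E).
  by rewrite lte_fin ltrDl invr_gt0.
apply: le_ereal_inf_tmp => _ [s [s0 ts] <-]; rewrite lee_fin leNgt.
apply/negP => sx; move: ts; rewrite ltNge => /negP; apply.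
by apply: le_trans Tn; apply: Tw => //; exact: ltW.
Qed.

Lemma inverse_subordinator_chernoff (t x u : R) :
  driftless_subordinator nu T -> 0 <= x -> 0 < u ->
  (completed_probability P [set w | (x%:E < inverse_subordinator T t w)%E] <=
   (expR (t * u - x * laplace_exponent nu u))%:E)%E.
Proof.
move=> [_ _ TL] x0 u0.
(* Monotonicity of the outer measure replaces {E(t) > x} by a measurable event. *)
apply: (@le_trans _ _ (P [set w | T x w <= t])).
  rewrite -measurable_mu_extE; last exact: measurable_le_RV.
  by apply: le_mu_ext => // w; exact: inverse_subordinator_gt_le.
(* The moment generating function of -T(x) at u is the Laplace transform of T(x). *)
have := chernoff (- T x : {RV P >-> R}) (- t) u0.
rewrite /mmt_gen_fun.
rewrite (_ : expR \o _ = fun w => expR (- (u * T x w))); last first.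
  by apply/funext => w /=; rewrite fctE mulNr mulrC.
rewrite TL// -EFinM -expRD addrC.
rewrite (_ : - (u * - t) = t * u); last by rewrite mulrN opprK mulrC.
rewrite (_ : [set w | _] = [set w | T x w <= t]) //.
by apply/seteqP; split => w /=; rewrite fctE lerN2.
Qed.

End inverse_subordinator.

Theorem proposition2p1 (R : realType) (d : measure_display)
    (Omega : measurableType d) (P : probability Omega R)
    (nu : {measure set R -> \bar R})
    (T : R -> {RV P >-> R}) :
  driftless_subordinator nu T ->
  nu [set` `]0, +oo[] != 0%E ->
  forall t : R, 0 < t ->
  \forall x \near +oo,
    let psi := laplace_exponent nu in
    let u := laplace_exponent'_inv nu (t / x) in
    let A := [set w | (x%:E < inverse_subordinator T t w)%E] in
    [/\ (derive1 psi @` [set` `]0, +oo[]) (t / x), completed_event P A &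
        (completed_probability P A <= (expR (t * u - x * psi u))%:E)%E].
Proof.
move=> TT nu0 t t0; have [[_ Tmon] nuL _] := TT.
have s0 := slope_gt0 nuL ltr01 nu0.
near=> x => /=.
have x0 : 0 < x by near: x; exact: nbhs_pinfty_gt.
have Itx : (derive1 (laplace_exponent nu) @` [set` `]0, +oo[]) (t / x).
  apply: laplace_exponent_derive1_onto => //.
  (* Since psi'(1) > 0, t/x < psi'(1) means x > t/psi'(1), which holds for large x. *)
  rewrite divr_gt0//= ltr_pdivrMr// mulrC -ltr_pdivrMr//.
  by near: x; apply: nbhs_pinfty_gt; rewrite num_real.
split => //.
- exact: inverse_subordinator_event (ltW x0) Tmon.
- apply: (inverse_subordinator_chernoff _ TT (ltW x0)).
  exact: laplace_exponent'_inv_gt0.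
Unshelve. all: by end_near. Qed.
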